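(* (i) Let $S$ be a right modular groupoid with a left identity element $l$, and let $[abc]=(ab)c$ be its natural ternary operation. Then $(S,[\ ])$ is a laterally commutative, $l$-bi-unital semiheap. (ii) Conversely, let $(S,[\ ])$ be a laterally commutative, $l$-bi-unital semiheap (with bi-unitary element $l\in S$). Define $a*b=[lab]$ for $a,b\in S$. Then $(S,* )$ is a right modular groupoid with left identity element $l$. (iii) Let $\Phi$ be the mapping that sends a right modular groupoid $S$ with left identity element $l$ to the laterally commutative, $l$-bi-unital semiheap $(S,[\ ],l)$ with $[abc]=(ab)c$, and let $\Gamma$ be the mapping that sends a laterally commutative semiheap $(S,[\ ])$ with bi-unitary element $l$ to $(S,*,l)$ with $a*b=[lab]$. Then $\Phi$ and $\Gamma$ are mutually inverse mappings.
   Context: A groupoid is a set with a binary operation, written as juxtaposition. A groupoid is right modular if $(xy)z=(zy)x$ for all $x,y,z$. A left identity is an element $l$ with $lx=x$ for all $x$. A set $S$ with a ternary operation $[\ ]$ is a semiheap if $[[xyz]uv]=[x[uzy]v]=[xy[zuv]]$ for all $x,y,z,u,v\in S$. A ternary operation is laterally commutative if $[xyz]=[zyx]$ for all $x,y,z$. An element $l$ is bi-unitary if $[llx]=x=[xll]$ for all $x\in S$; the ternary operation is called $l$-bi-unital if $l$ is a bi-unitary element of it. *)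

(* Defs.v *)
From mathcomp Require Import all_boot.

Set Implicit Arguments.
Unset Strict Implicit.
Unset Printing Implicit Defensive.

Definition right_modular (S : Type) (mul : S -> S -> S) : Prop :=
  forall x y z, mul (mul x y) z = mul (mul z y) x.

Definition semiheap (S : Type) (t : S -> S -> S -> S) : Prop :=
  forall x y z u v,
    t (t x y z) u v = t x (t u z y) v /\
    t x (t u z y) v = t x y (t z u v).

Definition laterally_commutative (S : Type) (t : S -> S -> S -> S) : Prop :=
  forall x y z, t x y z = t z y x.

Definition bi_unital (S : Type) (l : S) (t : S -> S -> S -> S) : Prop :=
  forall x, t l l x = x /\ t x l l = x.

Definition natural_ternary (S : Type) (mul : S -> S -> S) : S -> S -> S -> S :=
  fun a b c => mul (mul a b) c.

Definition induced_mul (S : Type) (l : S) (t : S -> S -> S -> S) : S -> S -> S :=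
  fun a b => t l a b.

Record pointed_groupoid (S : Type) := PointedGroupoid {
  pg_mul : S -> S -> S;
  pg_point : S
}.

Record pointed_ternary (S : Type) := PointedTernary {
  pt_op : S -> S -> S -> S;
  pt_point : S
}.

Definition is_rm_groupoid (S : Type) (G : pointed_groupoid S) : Prop :=
  right_modular (pg_mul G) /\ left_id (pg_point G) (pg_mul G).

Definition is_lc_semiheap (S : Type) (H : pointed_ternary S) : Prop :=
  [/\ semiheap (pt_op H), laterally_commutative (pt_op H)
    & bi_unital (pt_point H) (pt_op H)].

(* Phi and Gamma are defined on the underlying data only; the classes they are
   meant to relate are imposed as the predicates P and Q of
   [mutually_inverse_between]. *)
Definition Phi (S : Type) (G : pointed_groupoid S) : pointed_ternary S :=
  PointedTernary (natural_ternary (pg_mul G)) (pg_point G).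

Definition Gamma (S : Type) (H : pointed_ternary S) : pointed_groupoid S :=
  PointedGroupoid (induced_mul (pt_point H) (pt_op H)) (pt_point H).

Definition mutually_inverse_between (A B : Type) (P : A -> Prop) (Q : B -> Prop)
    (f : A -> B) (g : B -> A) : Prop :=
  [/\ forall x, P x -> Q (f x),
      forall y, Q y -> P (g y),
      forall x, P x -> g (f x) = x
    & forall y, Q y -> f (g y) = y].

(* Main.v *)
Require Import Defs.
From mathcomp Require Import all_boot.
From Stdlib Require Import FunctionalExtensionality.

(** A right modular groupoid is medial, so a left identity yields the exchange
law [a (b c) = b (a c)], from which the semiheap identities follow. Conversely,
the semiheap law gives [l [l a b] c = l b [a l c]], which is symmetric in [a]
and [c] (right modularity), and [c [l a b] l = [c b a] l l = c b a], so the
derived multiplication recovers the ternary operation. *)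

Section RightModular.

Variables (S : Type) (mul : S -> S -> S) (l : S).
Hypotheses (mulRM : right_modular mul) (mul1x : left_id l mul).
Local Notation "x * y" := (mul x y).

(** Swapping outer factors three times: [(ab)(cd) = ((cd)b)a = ((bd)c)a = (ac)(bd)]. *)
Lemma right_modular_medial a b c d : (a * b) * (c * d) = (a * c) * (b * d).
Proof. by rewrite mulRM (mulRM c d b) mulRM. Qed.

(** Writing the left-hand [a] as [l * a] lets mediality swap [a] and [b]. *)
Lemma right_modular_exchange a b c : a * (b * c) = b * (a * c).
Proof. by rewrite -{1}(mul1x a) right_modular_medial mul1x. Qed.

Lemma natural_ternary_semiheap : semiheap (natural_ternary mul).
Proof.
(* This is [[[xyz]uv] = [x[uzy]v]] before the last factor [v] is applied. *)
have shift x y z u : ((x * y) * z) * u = x * ((u * z) * y).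
  by rewrite mulRM right_modular_exchange.
move=> x y z u v; rewrite /natural_ternary; split; first by rewrite (shift x).
(* Back at [[[xyz]uv] = (vu)((xy)z)], exchange gives [(xy)((vu)z)], and [(vu)z = (zu)v]. *)
by rewrite -shift mulRM right_modular_exchange (mulRM v u z).
Qed.

Lemma natural_ternary_laterally_commutative :
  laterally_commutative (natural_ternary mul).
Proof. exact: mulRM. Qed.

Lemma natural_ternary_bi_unital : bi_unital l (natural_ternary mul).
Proof.
by move=> x; rewrite /natural_ternary (mulRM x) !mul1x.
Qed.

(** An equality of functions, hence extensionality: the round trips of [Phi] and [Gamma] compare
    records by Leibniz equality. *)
Lemma induced_mul_natural_ternary : induced_mul l (natural_ternary mul) = mul.
Proof.
apply: functional_extensionality => a; apply: functional_extensionality => b.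
by rewrite /induced_mul /natural_ternary mul1x.
Qed.

End RightModular.

Section Semiheap.

Variables (S : Type) (t : S -> S -> S -> S) (l : S).
Hypotheses (tS : semiheap t) (tC : laterally_commutative t).
Hypothesis t1 : bi_unital l t.

Lemma induced_mul_right_modular : right_modular (induced_mul l t).
Proof.
move=> x y z; rewrite /induced_mul.
by rewrite (tS l y x l z).2 (tS l y z l x).2 (tC x).
Qed.

Lemma induced_mul_left_id : left_id l (induced_mul l t).
Proof. by move=> x; case: (t1 x). Qed.

Lemma natural_ternary_induced_mul : natural_ternary (induced_mul l t) = t.
Proof.
apply: functional_extensionality => a; apply: functional_extensionality => b.
apply: functional_extensionality => c; rewrite /natural_ternary /induced_mul.
(* Reversing the outer product puts [l] last, so the semiheap law with [u = v = l] yields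
   [[[cba]ll]]; the last [tC] restores the order. *)
by rewrite tC -(tS c b a l l).1 (t1 _).2 tC.
Qed.

End Semiheap.

Theorem theorem20 :
  (forall (S : Type) (mul : S -> S -> S) (l : S),
     right_modular mul -> left_id l mul ->
     [/\ semiheap (natural_ternary mul),
         laterally_commutative (natural_ternary mul)
       & bi_unital l (natural_ternary mul)])
  /\
  (forall (S : Type) (t : S -> S -> S -> S) (l : S),
     semiheap t -> laterally_commutative t -> bi_unital l t ->
     right_modular (induced_mul l t) /\ left_id l (induced_mul l t))
  /\
  (forall S : Type,
     mutually_inverse_between (@is_rm_groupoid S) (@is_lc_semiheap S)
       (@Phi S) (@Gamma S)).
Proof.
have natural S (mul : S -> S -> S) l : right_modular mul -> left_id l mul ->
    [/\ semiheap (natural_ternary mul),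
        laterally_commutative (natural_ternary mul)
      & bi_unital l (natural_ternary mul)].
  move=> mulRM mul1x; split.
  - exact: natural_ternary_semiheap mulRM mul1x.
  - exact: natural_ternary_laterally_commutative.
  - exact: natural_ternary_bi_unital.
have induced S (t : S -> S -> S -> S) l :
    semiheap t -> laterally_commutative t -> bi_unital l t ->
    right_modular (induced_mul l t) /\ left_id l (induced_mul l t).
  move=> tS tC t1; split; first exact: induced_mul_right_modular.
  exact: induced_mul_left_id.
split=> //; split=> // S; split.
- by case=> mul l [mulRM mul1x]; apply: natural.
- by case=> t l [tS tC t1]; apply: induced.
(* Both maps keep the distinguished element, so only the operations remain to be compared. *)
- case=> mul l [mulRM mul1x].
  by rewrite /Gamma /Phi /= induced_mul_natural_ternary.
- case=> t l [tS tC t1].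
  by rewrite /Gamma /Phi /= natural_ternary_induced_mul.
Qed.
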